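(* Let $P$ be an Eulerian poset of rank $r$. The Eulerian Chow polynomial $\mathrm H_{\operatorname{Stell}(P)}(x)$ of the stellahedral transform of $P$ is determined by the Eulerian Chow polynomial $\mathrm H_P(x)$ of $P$, via the formulas $$\frac{\mathrm H_{\operatorname{Stell}(P)}(x)}{(1-x)^{r+1}}=\sum_{k=0}^{\infty}N(k)\,x^k=\sum_{k=0}^{\infty}\zeta_P(k+1)\,P_k(x),$$ where $$P_k(x):=\sum_{m=0}^{k}x^m\,\frac{m^{k-m}}{(m+1)^{k-m+1}},\qquad N(k):=\Bigl[\bigl((k+1)\delta-k\zeta\bigr)^{-1}\cdot\zeta^{k+1}\Bigr]_{\widehat 0\,\widehat 1},$$ with $\delta$ and $\zeta$ the identity and the zeta function in the incidence algebra of $P$, and $\zeta_P$ the zeta polynomial of $P$.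
   Context: Posets are finite, bounded (with minimum $\widehat 0$ and maximum $\widehat 1$) and graded with rank function $\rho$ (length of maximal chains from $\widehat 0$); the rank of $P$ is $\rho(\widehat 1)$ and $\rho_{st}=\rho(t)-\rho(s)$. $P$ is Eulerian if its Möbius function satisfies $\mu_{st}=(-1)^{\rho_{st}}$ for all $s\le t$. The stellahedral transform of an Eulerian poset is Eulerian. Stellahedral transform: $$\operatorname{Stell}(P)=\{(c,y): c=\{\widehat 0=c_0<c_1<\dots<c_k\}\text{ a chain in }P \ (k\ge 0),\ y\in P,\ c_k\le y\}\sqcup\{\widehat 1_{\operatorname{Stell}}\},$$ where $\widehat 1_{\operatorname{Stell}}$ is a maximum element and $(c,y)\le(c',y')$ if and only if $c\subseteq c'$ and $y\ge y'$ in $P$. Incidence algebra: functions $a$ assigning to each closed interval $[s,t]$ a polynomial $a_{st}(x)\in\mathbb Z[x]$, with product $(ab)_{st}=\sum_{s\le w\le t}a_{sw}b_{wt}$; $\delta_{ss}=1$, $\delta_{st}=0$ for $s<t$; $\zeta_{st}=1$ for all $s\le t$. Let $\overline\varepsilon_{st}=(x-1)^{\rho_{st}-1}$ for $s<t$, $\overline\varepsilon_{ss}=-1$, and $\mathrm H=-(\overline\varepsilon)^{-1}$; the Eulerian Chow polynomial of $P$ is $\mathrm H_P(x)=\mathrm H_{\widehat 0\widehat 1}(x)$. The zeta polynomial $\zeta_P(n)$ is the polynomial counting, for $n\ge1$, multichains $q_1\le\dots\le q_{n-1}$ in $P$ of size $n-1$. It is determined by $\mathrm H_P$ through $\sum_{n\ge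 0}\zeta_P(n+1)x^n=\mathrm H_P(x)/(1-x)^{r+1}$. Conventions: $0^0=1$; the identities are in $\mathbb R[[x]]$, where the last sum over $k$ is understood coefficientwise, each coefficient being a convergent series of real numbers. *)

(* Defs.v *)
From HB Require Import structures.
From mathcomp Require Import all_boot all_order all_algebra.
From mathcomp Require Import all_classical all_reals all_analysis.
Set Implicit Arguments.
Unset Strict Implicit.
Unset Printing Implicit Defensive.
Import Order.TTheory GRing.Theory Num.Theory.
Import numFieldNormedType.Exports.
Local Open Scope ring_scope.

Section Graded.
Context {d : Order.disp_t} {P : finTBPOrderType d}.
Implicit Types (c : {set P}) (t : P).

Definition is_chain c : bool :=
  [forall x in c, forall y in c, (x >=< y)%O].

(* Maximal chains from \bot to t, as vertex sets: a chain with n vertices has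
   length n.-1. *)
Definition is_maxchain_to t c : bool :=
  maxset [pred c' : {set P} | is_chain c' & [forall x in c', (x <= t)%O]] c.

(* The maximum only serves to make the definition total: for a graded poset all
   the maximal chains from \bot to t have the same length. *)
Definition rho t : nat := (\max_(c | is_maxchain_to t c) #|c|).-1.

End Graded.

Definition graded (d : Order.disp_t) (P : finTBPOrderType d) : Prop :=
  forall (t : P) (c : {set P}), is_maxchain_to t c -> #|c|.-1 = rho t.

Definition poset_rank (d : Order.disp_t) (P : finTBPOrderType d) : nat :=
  rho (\top%O : P).

Section IncidenceAlgebra.
Context (K : nzRingType) {d : Order.disp_t} (P : finTBPOrderType d).

Definition closed_interval : Type := {st : P * P | (st.1 <= st.2)%O}.
HB.instance Definition _ := Finite.on closed_interval.

Definition incalg : Type := {ffun closed_interval -> K}.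
HB.instance Definition _ := GRing.Zmodule.on incalg.

End IncidenceAlgebra.

Section IncidenceRing.
Context {K : nzRingType} {d : Order.disp_t} {P : finTBPOrderType d}.
Implicit Types (s t w : P) (f : P -> P -> K).

(* a_{st}, extended by 0 when [s, t] is not an interval. *)
Definition ia_val (a : incalg K P) s t : K :=
  if insub (s, t) is Some st then (a : {ffun closed_interval P -> K}) st else 0.

Definition ia_of f : incalg K P :=
  [ffun st : closed_interval P => f (val st).1 (val st).2].

Definition ia_mul (a b : incalg K P) : incalg K P :=
  ia_of (fun s t => \sum_(w | (s <= w <= t)%O) ia_val a s w * ia_val b w t).

Definition ia_delta : incalg K P := ia_of (fun s t => (s == t)%:R).

Definition ia_zeta : incalg K P := ia_of (fun _ _ => 1).

Implicit Types a b c : incalg K P.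

Lemma ia_ofE f s t : ia_val (ia_of f) s t = if (s <= t)%O then f s t else 0.
Proof.
rewrite /ia_val; case: ifPn => st; last by rewrite insubN.
by rewrite insubT ffunE.
Qed.

Lemma ia_val_out a s t : ~~ (s <= t)%O -> ia_val a s t = 0.
Proof. by move=> st; rewrite /ia_val insubN. Qed.

Lemma ia_ext a b :
  (forall s t, (s <= t)%O -> ia_val a s t = ia_val b s t) -> a = b.
Proof.
move=> ab; apply/ffunP => -[[s t] st]; have := ab s t st.
by rewrite /ia_val insubT.
Qed.

Lemma ia_valD a b s t : ia_val (a + b) s t = ia_val a s t + ia_val b s t.
Proof.
by rewrite /ia_val; case: insubP => [u _ _|_]; rewrite ?ffunE ?addr0.
Qed.

Lemma ia_mulE a b s t : ia_val (ia_mul a b) s t =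
  \sum_(w | (s <= w <= t)%O) ia_val a s w * ia_val b w t.
Proof.
rewrite ia_ofE; case: ifPn => // st; rewrite big1 // => w /andP[sw wt].
by rewrite (le_trans sw wt) in st.
Qed.

Lemma ia_mul_sum a b s t :
  ia_val (ia_mul a b) s t = \sum_w ia_val a s w * ia_val b w t.
Proof.
rewrite ia_mulE [RHS](bigID (fun w => (s <= w <= t)%O)) /= [X in _ + X]big1 ?addr0 //.
move=> w; rewrite negb_and => /orP[?|?]; first by rewrite ia_val_out ?mul0r.
by rewrite (ia_val_out b) ?mulr0.
Qed.

Lemma ia_mulA : associative ia_mul.
Proof.
move=> a b c; apply: ia_ext => s t _; rewrite !ia_mul_sum.
under eq_bigr do rewrite ia_mul_sum mulr_sumr.
under [RHS]eq_bigr do rewrite ia_mul_sum mulr_suml.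
rewrite exchange_big; apply: eq_bigr => v _; apply: eq_bigr => w _.
by rewrite mulrA.
Qed.

Lemma ia_mul1 : left_id ia_delta ia_mul.
Proof.
move=> a; apply: ia_ext => s t st; rewrite ia_mul_sum (bigD1 s) //= big1.
  by rewrite addr0 ia_ofE lexx eqxx mul1r.
by move=> w /negbTE ws; rewrite ia_ofE eq_sym ws if_same mul0r.
Qed.

Lemma ia_1mul : right_id ia_delta ia_mul.
Proof.
move=> a; apply: ia_ext => s t st; rewrite ia_mul_sum (bigD1 t) //= big1.
  by rewrite addr0 ia_ofE lexx eqxx mulr1.
by move=> w /negbTE ws; rewrite ia_ofE ws if_same mulr0.
Qed.

Lemma ia_mulDl : left_distributive ia_mul +%R.
Proof.
move=> a b c; apply: ia_ext => s t _; rewrite ia_valD !ia_mul_sum -big_split /=.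
by apply: eq_bigr => w _; rewrite ia_valD mulrDl.
Qed.

Lemma ia_mulDr : right_distributive ia_mul +%R.
Proof.
move=> a b c; apply: ia_ext => s t _; rewrite ia_valD !ia_mul_sum -big_split /=.
by apply: eq_bigr => w _; rewrite ia_valD mulrDr.
Qed.

Lemma ia_delta_neq0 : ia_delta != 0.
Proof.
apply/eqP => /(congr1 (fun a => ia_val a \bot%O \bot%O)).
rewrite ia_ofE lexx eqxx /ia_val; case: insubP => [u _ _|_].
  by rewrite ffunE; apply/eqP/oner_neq0.
by apply/eqP/oner_neq0.
Qed.

HB.instance Definition _ := GRing.Zmodule_isNzRing.Build (incalg K P)
  ia_mulA ia_mul1 ia_1mul ia_mulDl ia_mulDr ia_delta_neq0.

Definition ia_unit : pred (incalg K P) :=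
  fun a => `[< exists b, b * a = 1 /\ a * b = 1 >].

(* The two-sided inverse where it exists, the identity function elsewhere (the
   convention of unitRingType). *)
Definition ia_inv a : incalg K P :=
  if pselect (exists b, b * a = 1 /\ a * b = 1) is left ex
  then projT1 (cid ex) else a.

Lemma ia_mulVr : {in ia_unit, left_inverse 1 ia_inv *%R}.
Proof.
move=> a /asboolP ua; rewrite /ia_inv; case: pselect => // ex.
by case: cid => b /= [].
Qed.

Lemma ia_divrr : {in ia_unit, right_inverse 1 ia_inv *%R}.
Proof.
move=> a /asboolP ua; rewrite /ia_inv; case: pselect => // ex.
by case: cid => b /= [].
Qed.

Lemma ia_unitrP a b : b * a = 1 /\ a * b = 1 -> ia_unit a.
Proof. by move=> ab; apply/asboolP; exists b. Qed.

Lemma ia_inv_out : {in [predC ia_unit], ia_inv =1 id}.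
Proof.
move=> a /negP ua; rewrite /ia_inv; case: pselect => // ex.
by case: ua; apply/asboolP.
Qed.

HB.instance Definition _ := GRing.NzRing_hasMulInverse.Build (incalg K P)
  ia_mulVr ia_divrr ia_unitrP ia_inv_out.

Lemma ia_val0 s t : ia_val (0 : incalg K P) s t = 0.
Proof. by rewrite /ia_val; case: insubP => [u _ _|_] //; rewrite ffunE. Qed.

Lemma ia_valN a s t : ia_val (- a) s t = - ia_val a s t.
Proof. by apply/eqP; rewrite -addr_eq0 -ia_valD addNr ia_val0. Qed.

Lemma ia_valMn a n s t : ia_val (a *+ n) s t = ia_val a s t *+ n.
Proof.
by elim: n => [|n IH]; rewrite ?mulr0n ?ia_val0 // !mulrS ia_valD IH.
Qed.

Lemma ia_valM a b s t : ia_val (a * b) s t =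
  \sum_(w | (s <= w <= t)%O) ia_val a s w * ia_val b w t.
Proof. exact: ia_mulE. Qed.

Lemma ia_val1 s t : ia_val (1 : incalg K P) s t = (s == t)%:R.
Proof. by rewrite ia_ofE; case: ifPn => // st; case: eqP st => // ->; rewrite lexx. Qed.

Lemma ia_nilpotent a : (forall s, ia_val a s s = 0) -> a ^+ #|P| = 0.
Proof.
move=> a0.
suff H : forall n s t, (#|[set w | (s < w <= t)%O]| < n)%N ->
    ia_val (a ^+ n) s t = 0.
  apply: ia_ext => s t st; rewrite ia_val0; apply: H.
  rewrite -cardsT; apply: proper_card; apply/properP; split=> [|]; first exact: finset.subsetT.
  by exists s; rewrite !inE // ltxx.
elim=> // n IH s t lt; rewrite exprS ia_valM big1 // => w /andP[sw wt].
have [<-|nsw] := eqVneq s w; first by rewrite a0 mul0r.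
rewrite IH ?mulr0 //; apply: leq_trans (lt : (_ <= n)%N).
apply: proper_card; apply/properP; split.
  by apply/fintype.subsetP => v; rewrite !inE => /andP[wv ->]; rewrite (le_lt_trans sw wv).
by exists w; rewrite !inE ?ltxx // wt andbT lt_neqAle nsw.
Qed.

Lemma ia_unit_diag1 a : (forall s, ia_val a s s = 1) -> a \is a GRing.unit.
Proof.
move=> a1; have a0 s : ia_val (1 - a) s s = 0.
  by rewrite ia_valD ia_valN ia_val1 eqxx a1 subrr.
have an := ia_nilpotent a0; set b := 1 - a in an.
have -> : a = 1 - b by rewrite opprB addrC subrK.
have bb : (1 - b) * (\sum_(i < #|P|) b ^+ i) = 1.
  by rewrite -opprB mulNr -subrX1 an sub0r opprK.
apply/unitrP; exists (\sum_(i < #|P|) b ^+ i); split=> //.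
rewrite -[RHS]bb; apply/esym; apply: GRing.commr_sum => i _; apply: commrX.
by apply/commr_sym; apply: commrB; [exact: commr1 | exact: commr_refl].
Qed.

End IncidenceRing.

Arguments ia_zeta {K d} P.

Definition mobius (d : Order.disp_t) (P : finTBPOrderType d) : incalg int P :=
  (ia_zeta P)^-1.

Definition eulerian (d : Order.disp_t) (P : finTBPOrderType d) : Prop :=
  graded P /\
  forall s t : P, (s <= t)%O ->
    ia_val (mobius P) s t = (-1) ^+ (rho t - rho s)%N.

Definition eps_bar (d : Order.disp_t) (P : finTBPOrderType d) :
    incalg {poly int} P :=
  ia_of (fun s t : P =>
    if s == t then -1 else ('X - 1) ^+ (rho t - rho s).-1).

Definition chow_function (d : Order.disp_t) (P : finTBPOrderType d) :
    incalg {poly int} P :=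
  - (eps_bar P)^-1.

Definition eulerian_chow (d : Order.disp_t) (P : finTBPOrderType d) :
    {poly int} :=
  ia_val (chow_function P) \bot%O \top%O.

Lemma eps_bar_unit (d : Order.disp_t) (P : finTBPOrderType d) :
  eps_bar P \is a GRing.unit.
Proof.
rewrite -unitrN; apply: ia_unit_diag1 => s.
by rewrite ia_valN ia_ofE lexx eqxx opprK.
Qed.

Section Stell.
Context {d : Order.disp_t} (P : finTBPOrderType d).

(* A chain \bot = c_0 < ... < c_k is the totally ordered set of its members; the
   condition c_k <= y says that y is an upper bound of this set. *)
Definition stell_pair (cy : {set P} * P) : bool :=
  [&& \bot%O \in cy.1, is_chain cy.1 & [forall x in cy.1, (x <= cy.2)%O]].

(* [None] is the adjoined maximum. *)
Definition stell : Type := option {cy : {set P} * P | stell_pair cy}.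
HB.instance Definition _ := Finite.on stell.

Definition stell_le (a b : stell) : bool :=
  match a, b with
  | _, None => true
  | None, Some _ => false
  | Some u, Some v =>
      ((val u).1 \subset (val v).1) && ((val v).2 <= (val u).2)%O
  end.

Lemma stell_le_refl : reflexive stell_le.
Proof. by case=> //= u; rewrite subxx lexx. Qed.

Lemma stell_le_anti : antisymmetric stell_le.
Proof.
case=> [u|] [v|] //= /andP[/andP[uv1 uv2] /andP[vu1 vu2]].
congr Some; apply: val_inj; apply/eqP; rewrite -pair_eqE /=; apply/andP; split.
  by rewrite finset.eqEsubset uv1.
by rewrite eq_le vu2.
Qed.

Lemma stell_le_trans : transitive stell_le.
Proof.
case=> [v|] [u|] [w|] //= /andP[uv1 uv2] /andP[vw1 vw2].
by rewrite (fintype.subset_trans uv1 vw1) (le_trans vw2 uv2).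
Qed.

Fact stell_display : Order.disp_t. Proof. exact: (Order.Disp tt tt). Qed.

HB.instance Definition _ := Order.Le_isPOrder.Build stell_display stell
  stell_le_refl stell_le_anti stell_le_trans.

Fact stell_bot_subproof : stell_pair ([set \bot%O], \top%O).
Proof.
apply/and3P; split; rewrite /= ?inE //.
  by apply/forall_inP => x /set1P->; apply/forall_inP => y /set1P->; apply: comparablexx.
by apply/forall_inP => x _; apply: lex1.
Qed.

Definition stell_bot : stell := Some (exist (fun cy => stell_pair cy) _ stell_bot_subproof).

Lemma stell_le_bot (a : stell) : (stell_bot <= a)%O.
Proof.
case: a => [[[c y] /= cy]|] //; apply/andP; split=> /=; last exact: lex1.
by rewrite finset.sub1set; case/and3P: cy.
Qed.

Lemma stell_le_top (a : stell) : (a <= None :> stell)%O.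
Proof. by case: a. Qed.

HB.instance Definition _ :=
  Order.hasBottom.Build stell_display stell stell_le_bot.
HB.instance Definition _ :=
  Order.hasTop.Build stell_display stell stell_le_top.

End Stell.

Section ZetaPoly.
Context {d : Order.disp_t} (P : finTBPOrderType d).

Definition num_multichains (n : nat) : nat :=
  #|[set q : n.-tuple P | sorted <=%O q]|.

Definition is_zeta_poly (R : realType) (Z : {poly R}) : Prop :=
  forall n : nat, (1 <= n)%N -> Z.[n%:R] = (num_multichains n.-1)%:R.

Definition zeta_poly (R : realType) : {poly R} :=
  xget 0 [set Z | is_zeta_poly Z]%classic.

Lemma ia_zeta_path (n : nat) (s t : P) :
  ia_val (ia_zeta P ^+ n.+1 : incalg int P) s t =
  #|[set q : n.-tuple P | path <=%O s (rcons q t)]|%:R.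
Proof.
elim: n s => [|n IH] s.
  rewrite expr1 ia_ofE; set A := finset _.
  have -> : A = if (s <= t)%O then [set [tuple]] else finset.set0.
    by apply/setP => q; rewrite (tuple0 q) /A; case: ifP; rewrite !inE /= ?andbT.
  by case: ifP; rewrite ?cards1 ?cards0.
rewrite exprS ia_valM; under eq_bigr => w /andP[sw _].
  rewrite ia_ofE sw mul1r IH; over.
rewrite -natr_sum; congr _%:R.
rewrite -sum1_card (reindex (fun x : P * n.-tuple P => [tuple of x.1 :: x.2])) /=.
  rewrite big_mkcond /= (eq_bigr (fun w => \sum_(q : n.-tuple P)
    (if path <=%O s (w :: rcons q t) then 1 else 0)%N)).
    rewrite pair_big /= [RHS]big_mkcond; apply: eq_bigr => -[w q] _.
    by rewrite inE.
  move=> w _; rewrite -sum1_card big_mkcond /= -big_mkcond /=.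
  case: ifP => [/andP[sw wt]|nw].
    by rewrite [LHS]big_mkcond; apply: eq_bigr => q _; rewrite inE /= sw.
  rewrite big1 // => q _; case: ifP => //= /andP[sw pw].
  move: nw; rewrite sw /=; move: pw; rewrite (path_sortedE le_trans).
  by rewrite all_rcons => /andP[/andP[-> _] _].
exists (fun q : n.+1.-tuple P => (thead q, [tuple of behead q])).
  by case=> w q _; congr pair; apply: val_inj.
by move=> q _; rewrite [RHS]tuple_eta; apply: val_inj.
Qed.

Lemma ia_zeta_multichains (n : nat) :
  ia_val (ia_zeta P ^+ n.+1 : incalg int P) \bot%O \top%O =
  (num_multichains n)%:R.
Proof.
rewrite ia_zeta_path; congr _%:R; apply: eq_card => q; rewrite !inE.
rewrite rcons_path lex1 andbT; case: (tval q) => //= x l.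
by rewrite le0x.
Qed.

Lemma binomial_poly (R : realType) (j : nat) :
  exists B : {poly R}, forall n : nat, B.[n%:R] = 'C(n, j)%:R.
Proof.
elim: j => [|j [B HB]]; first by exists 1 => n; rewrite hornerE bin0.
exists (j.+1%:R^-1 *: (('X - j%:R%:P) * B)) => n.
have j0 : j.+1%:R != 0 :> R by rewrite pnatr_eq0.
rewrite hornerZ hornerM hornerXsubC HB; apply: (mulfI j0).
rewrite mulVKf // -natrM mul_bin_left natrM; have [jn|nj] := leqP j n.
  by rewrite natrB.
by rewrite bin_small // !mulr0.
Qed.

Lemma zeta_poly_exists (R : realType) : exists Z : {poly R}, is_zeta_poly Z.
Proof.
pose z : incalg int P := ia_zeta P - 1.
have zn : z ^+ #|P| = 0.
  by apply: ia_nilpotent => s; rewrite ia_valD ia_valN ia_val1 ia_ofE lexx eqxx subrr.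
have zN i : (#|P| <= i)%N -> z ^+ i = 0.
  by move=> /subnK <-; rewrite exprD zn mulr0.
pose B j := sval (cid (binomial_poly R j)).
have BE j n : (B j).[n%:R] = 'C(n, j)%:R by rewrite /B; case: cid.
exists (\sum_(j < #|P|) (ia_val (z ^+ j) \bot%O \top%O)%:~R *: B j).
case=> // n _; rewrite horner_sum /=.
have -> : (num_multichains n)%:R =
    ((num_multichains n)%:R : int)%:~R :> R by rewrite rmorph_nat.
rewrite -ia_zeta_multichains -[ia_zeta P](subrK 1) -/z addrC.
rewrite (exprDn_comm _ (commr_sym (commr1 z))).
have vsum I r (F : I -> incalg int P) :
    ia_val (\sum_(i <- r) F i) \bot%O \top%O = \sum_(i <- r) ia_val (F i) \bot%O \top%O.
  by elim/big_rec2: _ => [|i x y _ <-]; rewrite ?ia_val0 ?ia_valD.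
rewrite vsum rmorph_sum /=.
under [RHS]eq_bigr do rewrite expr1n mul1r ia_valMn rmorphMn /= -mulr_natr.
under eq_bigr do rewrite hornerZ BE.
pose F i := (ia_val (z ^+ i) \bot%O \top%O)%:~R * 'C(n.+1, i)%:R : R.
have widen m : (m <= #|P| + n.+2)%N -> (forall i, (m <= i)%N -> F i = 0) ->
    \sum_(i < m) F i = \sum_(i < #|P| + n.+2) F i.
  move=> mM F0; rewrite (big_ord_widen _ F mM) big_mkcond.
  by apply: eq_bigr => i _; case: ltnP => // /F0.
rewrite (widen #|P|) ?(widen n.+2) // ?leq_addr ?leq_addl // => i i_ge.
  by rewrite /F bin_small ?mulr0.
by rewrite /F zN // ia_val0 mul0r.
Qed.

Lemma zeta_polyP (R : realType) : is_zeta_poly (zeta_poly R).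
Proof. by case: (zeta_poly_exists R) => Z ZP; apply: (xgetPex 0 (ex_intro _ Z ZP)). Qed.

Lemma zeta_poly_unique (R : realType) (Z : {poly R}) :
  is_zeta_poly Z -> Z = zeta_poly R.
Proof.
move=> ZP; apply/eqP; rewrite -subr_eq0; apply/eqP.
apply: (@roots_geq_poly_eq0 _ _
  [seq n.+1%:R | n <- iota 0 (size (Z - zeta_poly R))]).
- apply/allP => _ /mapP[n _ ->].
  by rewrite rootE hornerD hornerN ZP // zeta_polyP // subrr.
- rewrite map_inj_uniq ?iota_uniq // => m n /eqP.
  by rewrite eqr_nat eqSS => /eqP.
- by rewrite size_map size_iota.
Qed.

End ZetaPoly.

(* The value at n is the coefficient of x^n. *)
Definition fps (K : fieldType) : Type := nat -> K.

Section FpsTheory.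
Context {K : fieldType}.
Implicit Types f g : fps K.

Definition fps_of_poly (p : {poly K}) : fps K := fun n => p`_n.

Definition fps_mul f g : fps K := fun n => \sum_(i < n.+1) f i * g (n - i)%N.

(* The first n coefficients of the inverse of f, for f with a nonzero constant term. *)
Fixpoint fps_inv_seq f (n : nat) : seq K :=
  if n is m.+1 then
    let s := fps_inv_seq f m in
    rcons s ((f 0%N)^-1 * ((m == 0%N)%:R - \sum_(i < m) f (m - i)%N * s`_i))
  else [::].

Definition fps_inv f : fps K := fun n => (fps_inv_seq f n.+1)`_n.

Definition fps_div f g : fps K := fps_mul f (fps_inv g).

Lemma size_fps_inv_seq f n : size (fps_inv_seq f n) = n.
Proof. by elim: n => //= n IH; rewrite size_rcons IH. Qed.

Lemma fps_inv_seqE f n i : (i < n)%N -> (fps_inv_seq f n)`_i = fps_inv f i.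
Proof.
elim: n => // n IH; rewrite ltnS leq_eqVlt => /predU1P[-> //|lt].
by rewrite /= nth_rcons size_fps_inv_seq lt IH.
Qed.

Lemma fps_mulVr f : f 0%N != 0 ->
  fps_mul (fps_inv f) f = fps_of_poly 1.
Proof.
move=> f0; apply/funext => n; rewrite /fps_mul /fps_of_poly coef1.
rewrite big_ord_recr /= subnn {2}/fps_inv /= nth_rcons size_fps_inv_seq ltnn eqxx.
rewrite mulrAC mulVf // mul1r addrC -addrA [X in _ + X](_ : _ = 0) ?addr0 //.
rewrite addrC; apply/eqP; rewrite subr_eq0; apply/eqP; apply: eq_bigr => i _.
by rewrite fps_inv_seqE // mulrC.
Qed.

End FpsTheory.

(* Convergence of an infinite sum in R[[x]], coefficient by coefficient. *)
Definition fps_sum_cvg (R : realType) (F : nat -> fps R) (G : fps R) : Prop :=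
  forall m : nat, (series (fun k => F k m) @ \oo --> G m)%classic.

(* The functions involved have constant values, so that the computation takes
   place in the subalgebra of functions with values in the integers. *)
Definition stell_N (d : Order.disp_t) (P : finTBPOrderType d) (k : nat) : int :=
  ia_val ((ia_delta *+ k.+1 - ia_zeta P *+ k)^-1 * ia_zeta P ^+ k.+1)
    \bot%O \top%O.

Lemma stell_N_unit (d : Order.disp_t) (P : finTBPOrderType d) (k : nat) :
  (ia_delta *+ k.+1 - ia_zeta P *+ k : incalg int P) \is a GRing.unit.
Proof.
apply: ia_unit_diag1 => s; rewrite ia_valD ia_valN !ia_valMn.
by rewrite !ia_ofE lexx eqxx mulrSr addrAC subrr add0r.
Qed.

Definition stell_poly (R : realType) (k : nat) : {poly R} :=
  \sum_(m < k.+1) (m%:R ^+ (k - m) / m.+1%:R ^+ (k - m).+1) *: 'X^m.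

(* Main.v *)
Require Import Defs.
From HB Require Import structures.
From mathcomp Require Import all_boot all_order all_algebra.
From mathcomp Require Import all_classical all_reals all_analysis.
From mathcomp Require Import zify ring lra.
Set Implicit Arguments.
Unset Strict Implicit.
Unset Printing Implicit Defensive.
Import Order.TTheory GRing.Theory Num.Theory.
Import numFieldNormedType.Exports.
Local Open Scope ring_scope.

(** Write [H_t] for the entry of the Chow function between the minimum and [t].
    The defining relation of the Chow function is a recursion expressing [H_t]
    through the [H_s] with [s < t], each multiplied by a power of [x - 1].  Under
    the substitution [H_t = (1 - x) ^ (rho t + 1) * sum_k F_t(k) x^k] all the
    powers of [1 - x] become equal, up to sign, and the recursion turns into the
    combinatorial identity

      [sum_(s <= t) (-1) ^ (rho t - rho s) F_s(k) = F_t(k - 1)],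

    read with [F_t(-1) = [t = minimum]] (lemma [chow_bot_coef]).  If the Moebius
    function is the sign of the rank, the left side is the product of [F] by the
    Moebius function, so [F_t(k)], the value between the minimum and [t] of
    [zeta ^ (k + 1)], is a solution; this gives the relation between the Chow
    polynomial and the zeta polynomial of an Eulerian poset
    ([eulerian_chow_coef]).

    In the stellahedral transform only the intervals below the adjoined maximum
    are needed.  The elements below a pair [(c, y)] form the product of the
    Boolean algebra of the non-minimal members of [c] with the dual of [[y, 1]],
    so the same identity is solved by
    [F_(c, y)(k) = (k + 1) ^ (#|c| - 1) * zeta ^ (k + 1) (y, 1)].  Applying the
    recursion once more, at the maximum, yields ([stell_chow_coef])

      [H_Stell / (1 - x) ^ (r + 1) =
        sum_k x^k sum_((c, y)) (-1) ^ (#|c| - 1 + rho y) F_(c, y)(k)].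

    For fixed [y] the sum over [c] is the generating function of the chains
    bounded by [y], at the parameter [- (k + 1)], that is, the entry [(0, y)] of
    [((k + 1) zeta - k) ^ -1 * zeta].  Multiplying the entries by the sign
    of the rank is an automorphism of the incidence algebra that exchanges zeta
    and the Moebius function, and it carries this element to
    [((k + 1) - k zeta) ^ -1].  The coefficient of [x^k] is therefore [N(k)]
    ([sum_stell_pair_N]).

    For the second series, [((m + 1) - m zeta) ^ -1] is expanded as the geometric
    series [sum_j m ^ j / (m + 1) ^ (j + 1) zeta ^ j].  It converges entrywise, as
    the entries of [zeta ^ j] grow polynomially in [j] ([cvg_stell_N]).  Finally,
    the Chow polynomial of [P] and the rank determine the numbers of multichains,
    hence the zeta polynomial, hence the second series. *)

(** * Rank functions of finite posets *)

Section Rank.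
Context {d : Order.disp_t} {P : finTBPOrderType d}.
Implicit Types (c : {set P}) (s t x y : P).

Lemma is_chainP c :
  reflect {in c &, forall x y, (x >=< y)%O} (is_chain c).
Proof.
apply: (iffP forall_inP) => [H x y xc yc|H x xc]; first exact: (forall_inP (H x xc)).
by apply/forall_inP => y yc; apply: H.
Qed.

Lemma is_chain_sub c c' : c' \subset c -> is_chain c -> is_chain c'.
Proof.
move=> /fintype.subsetP sub /is_chainP ch; apply/is_chainP => x y /sub xc /sub.
exact: ch.
Qed.

Lemma is_chain_add t c : is_chain c -> {in c, forall x, (x <= t)%O} ->
  is_chain (t |: c).
Proof.
move=> /is_chainP ch ct; apply/is_chainP => x y /setU1P[->|xc] /setU1P[->|yc].
- exact: comparablexx.
- by rewrite comparable_sym le_comparable // ct.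
- by rewrite le_comparable // ct.
- exact: ch.
Qed.

Lemma card_chain_le_rho t c : is_chain c -> {in c, forall x, (x <= t)%O} ->
  (#|c| <= (rho t).+1)%N.
Proof.
move=> ch ct.
have [|m mP cm] := @maxset_exists P
  [pred c' : {set P} | is_chain c' & [forall x in c', (x <= t)%O]] c.
  by rewrite /= ch; apply/forall_inP.
rewrite (leq_trans (subset_leq_card cm)) // (leq_trans _ (leqSpred _)) //.
exact: (@leq_bigmax_cond _ (is_maxchain_to t) (fun c : {set P} => #|c|) m mP).
Qed.

Lemma maxchain_toP t c : is_maxchain_to t c ->
  [/\ is_chain c, {in c, forall x, (x <= t)%O} & t \in c].
Proof.
move=> /maxsetP[/andP[ch /forall_inP ct] cmax]; split=> //.
rewrite -(cmax (t |: c)) ?finset.subsetUr ?setU11 //= is_chain_add //=.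
by apply/forall_inP => x /setU1P[->|/ct].
Qed.

Lemma rho_maxchain t :
  exists2 c, is_maxchain_to t c & #|c| = (rho t).+1.
Proof.
have [|m mP _] := @maxset_exists P
  [pred c' : {set P} | is_chain c' & [forall x in c', (x <= t)%O]] finset.set0.
  by apply/andP; split; apply/forall_inP => x; rewrite inE.
have gt0 : (0 < #|is_maxchain_to t|)%N by apply/card_gt0P; exists m.
have [c cP cE] := eq_bigmax_cond (fun c : {set P} => #|c|) gt0.
exists c => //; rewrite /rho cE prednK // card_gt0; apply/set0Pn; exists t.
by case: (maxchain_toP cP).
Qed.

Lemma rho_lt s t : (s < t)%O -> (rho s < rho t)%N.
Proof.
move=> st; have [c /maxchain_toP[ch cs _] cE] := rho_maxchain s.
have ct x : x \in c -> (x < t)%O by move=> /cs xs; apply: le_lt_trans st.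
rewrite -ltnS -cE -[(#|c|).+1]/(1 + #|c|)%N.
have tc : t \notin c by apply/negP => /ct; rewrite ltxx.
rewrite -[1%N]/(nat_of_bool true) -tc -cardsU1.
apply: card_chain_le_rho; first by apply: is_chain_add => // x /ct/ltW.
by move=> x /setU1P[->|/ct/ltW].
Qed.

Lemma rho_le s t : (s <= t)%O -> (rho s <= rho t)%N.
Proof. by rewrite le_eqVlt => /predU1P[->|/rho_lt/ltnW]. Qed.

(** A strictly increasing natural-valued function that never has to jump by more
    than one bounds the length of every chain and is attained by one, so it can
    only be the rank function. *)
Lemma rho_unique (f : P -> nat) : f \bot%O = 0%N ->
  (forall s t, (s < t)%O -> (f s < f t)%N) ->
  (forall t, t != \bot%O -> exists2 s, (s < t)%O & f t = (f s).+1) ->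
  forall t, rho t = f t.
Proof.
move=> f0 fmono fpred t; apply/eqP; rewrite eqn_leq; apply/andP; split.
  have [c /maxchain_toP[/is_chainP ch ct _] cE] := rho_maxchain t.
  rewrite -ltnS -cE -[X in (_ <= X)%N]card_ord.
  pose g x : 'I_(f t).+1 := inord (f x).
  rewrite -(@card_in_imset _ _ g) ?max_card // => x y xc yc.
  have lt z : z \in c -> (f z < (f t).+1)%N.
    by move=> /ct; rewrite le_eqVlt ltnS => /predU1P[->|/fmono/ltnW].
  move=> /(congr1 val); rewrite /= !inordK ?lt // => fxy.
  case: (comparable_ltgtP (ch _ _ xc yc)) => // /fmono; rewrite fxy ltnn //.
move: {2}(f t) (leqnn (f t)) => n; elim: n t => [|n IH] t.
  by rewrite leqn0 => /eqP->.
have [->|/fpred[s st ->]] := eqVneq t \bot%O; first by rewrite f0.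
by rewrite ltnS => /IH fs; rewrite (leq_ltn_trans fs) // rho_lt.
Qed.

Lemma rho_bot : rho (\bot%O : P) = 0%N.
Proof.
have [c /maxchain_toP[_ c0 _] cE] := rho_maxchain (\bot%O : P).
have : (#|c| <= #|[set \bot%O : P]|)%N.
  by apply/subset_leq_card/fintype.subsetP => x /c0; rewrite lex0 inE.
by rewrite cards1 cE ltnS leqn0 => /eqP.
Qed.

(** A maximal chain up to [s], extended by an element [t] just above [s], is still
    maximal; gradedness then compares its length with [rho t]. *)
Lemma graded_cover : graded P -> forall s, s != \top%O ->
  exists2 t, (s < t)%O & rho t = (rho s).+1.
Proof.
move=> gP s s1; have s1' : (s < \top)%O by rewrite lt_neqAle s1 lex1.
(* An element of least rank above [s] has nothing between it and [s]. *)
have [t st tmin] := @arg_minnP P (\top%O) (fun t => (s < t)%O) rho s1'.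
exists t => //; have [c cmax cE] := rho_maxchain s.
have [ch cs sc] := maxchain_toP cmax.
have ct x : x \in c -> (x < t)%O by move=> /cs xs; apply: le_lt_trans st.
have tc : t \notin c by apply/negP => /ct; rewrite ltxx.
suff /gP : is_maxchain_to t (t |: c) by rewrite cardsU1 tc cE => <-.
apply/maxsetP; split=> /=.
  rewrite is_chain_add //=; last by move=> x /ct/ltW.
  by apply/forall_inP => x /setU1P[->|/ct/ltW].
move=> c' /andP[ch' /forall_inP ct'] sub.
apply/eqP; rewrite finset.eqEsubset sub andbT.
have sub' : c \subset c' := fintype.subset_trans (finset.subsetUr _ _) sub.
apply/fintype.subsetP => x xc'; rewrite in_setU1.
have := ct' x xc'; rewrite le_eqVlt => /predU1P[->|xt]; first by rewrite eqxx.
have xs : (x >=< s)%O.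
  by apply: (is_chainP _ ch') => //; apply: (fintype.subsetP sub').
case: (comparable_ltgtP xs) => [ltxs|ltsx|->]; last by rewrite sc orbT.
  move/maxsetP: cmax => [_ cmax].
  rewrite -(cmax (x |: c)) ?finset.subsetUr ?setU11 ?orbT //=.
  apply/andP; split.
    apply: is_chain_sub ch'; apply/fintype.subsetP => y /setU1P[->//|].
    exact: (fintype.subsetP sub').
  by apply/forall_inP => y /setU1P[->|/cs //]; apply: ltW.
by move: (rho_lt xt); rewrite ltnNge tmin.
Qed.

End Rank.

(** * Powers of 1 - x acting on coefficient sequences *)

(** Multiplication of power series by [1 - x].  Working with this operator rather
    than with quotients keeps the Chow recursion inside integer sequences. *)
Definition bdiff (V : zmodType) (f : nat -> V) (k : nat) : V :=
  f k - (if k is k'.+1 then f k' else 0).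

Lemma iter_bdiff_sum (K : nzRingType) (I : Type) (s : seq I) (A : pred I)
    (c : I -> K) (F : I -> nat -> K) (n : nat) :
  iter n (@bdiff K) (fun k => \sum_(i <- s | A i) c i * F i k) =
  (fun k => \sum_(i <- s | A i) c i * iter n (@bdiff K) (F i) k).
Proof.
elim: n => //= n ->; apply/funext => k; rewrite /bdiff.
case: k => [|k]; first by rewrite subr0; apply: eq_bigr => i _; rewrite subr0.
by rewrite -sumrB; apply: eq_bigr => i _; rewrite mulrBr.
Qed.

Lemma bdiff_inj (V : zmodType) : injective (@bdiff V).
Proof.
move=> f g fg; apply/funext; elim=> [|k IH].
  by have := congr1 (fun h => h 0%N) fg; rewrite /bdiff !subr0.
have := congr1 (fun h => h k.+1) fg; rewrite /bdiff IH => /(congr1 (+%R^~ (g k))).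
by rewrite !subrK.
Qed.

Lemma iter_bdiff_inj (V : zmodType) (n : nat) : injective (iter n (@bdiff V)).
Proof. by elim: n => // n IH f g /= /bdiff_inj /IH. Qed.

Lemma iter_bdiff_intr (K : nzRingType) (f : nat -> int) (n : nat) :
  iter n (@bdiff K) (fun k => (f k)%:~R) =
  (fun k => (iter n (@bdiff int) f k)%:~R).
Proof.
elim: n => //= n ->; apply/funext => k; rewrite /bdiff intrB.
by case: k.
Qed.

Lemma coef_1subX_mul (K : nzRingType) (p : {poly K}) (n : nat) :
  nth 0 ((1 - 'X) ^+ n * p) = iter n (@bdiff K) (nth 0 p).
Proof.
elim: n => [|n IH]; first by rewrite expr0 mul1r.
rewrite exprS -mulrA /= -IH; apply/funext => k.
by rewrite mulrBl mul1r coefB coefXM /bdiff; case: k.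
Qed.

Lemma coef_mul_Xsub1 (K : comNzRingType) (p : {poly K}) (n k : nat) :
  (p * ('X - 1) ^+ n)`_k = (-1) ^+ n * iter n (@bdiff K) (nth 0 p) k.
Proof.
have -> : p * ('X - 1) ^+ n = (-1) ^+ n * ((1 - 'X) ^+ n * p).
  by rewrite -(opprB 1 'X) (exprNn (1 - 'X)) mulrC mulrA.
rewrite -coef_1subX_mul.
by rewrite -[(-1) ^+ n]signr_odd -[(-1) ^+ n in RHS]signr_odd !mulr_sign;
   case: (odd n) => //; rewrite coefN.
Qed.

Lemma fps_mul_bdiffr (K : fieldType) (f g : fps K) :
  fps_mul f (bdiff g) = bdiff (fps_mul f g).
Proof.
apply/funext => -[|n]; rewrite /bdiff /fps_mul.
  by rewrite !big_ord_recl !big_ord0 /= !subr0.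
rewrite big_ord_recr [in RHS]big_ord_recr /= subnn subr0 addrAC -sumrB.
congr (_ + _); apply: eq_bigr => i _; rewrite mulrBr /=.
by rewrite subSn // -ltnS.
Qed.

Lemma fps_mul_iter_bdiffr (K : fieldType) (f g : fps K) (n : nat) :
  fps_mul f (iter n (@bdiff K) g) = iter n (@bdiff K) (fps_mul f g).
Proof. by elim: n => //= n <-; rewrite fps_mul_bdiffr. Qed.

Lemma fps_mul1 (K : fieldType) (f : fps K) : fps_mul f (fps_of_poly 1) = f.
Proof.
apply/funext => n; rewrite /fps_mul /fps_of_poly big_ord_recr /= subnn coef1 mulr1.
rewrite big1 ?add0r // => i _; rewrite coef1 subn_eq0 leqNgt ltn_ord mulr0 //.
Qed.

(** Multiplication by [1 - x] is injective and commutes with multiplication by a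
    fixed series, so to divide by [(1 - x) ^ n] it suffices to exhibit a series
    that the [n]-fold operator sends to the numerator. *)
Lemma fps_div_1subX (K : fieldType) (p : {poly K}) (f : fps K) (n : nat) :
  nth 0 p = iter n (@bdiff K) f ->
  fps_div (fps_of_poly p) (fps_of_poly ((1 - 'X) ^+ n)) = f.
Proof.
have gE : fps_of_poly ((1 - 'X) ^+ n) = iter n (@bdiff K) (fps_of_poly 1).
  by have := coef_1subX_mul (1 : {poly K}) n; rewrite mulr1.
set g := fps_of_poly _ in gE * => pE.
have g0 : g 0%N != 0.
  suff -> : g 0%N = 1 by rewrite oner_neq0.
  rewrite gE; elim: n {g gE pE} => [|n IH] /=; first by rewrite /fps_of_poly coef1.
  by rewrite /bdiff subr0.
have gV : iter n (@bdiff K) (fps_inv g) = fps_of_poly 1.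
  by rewrite -[RHS](fps_mulVr g0) [X in fps_mul _ X]gE fps_mul_iter_bdiffr fps_mul1.
apply: (@iter_bdiff_inj K n).
by rewrite /fps_div -fps_mul_iter_bdiffr gV fps_mul1 -pE.
Qed.

(** * The Chow function above the minimum, in terms of multichains *)

Section ChowFromBottom.
Context {d : Order.disp_t} (L : finTBPOrderType d).
Implicit Types (s t : L).

Lemma chow_bot_rec t : ia_val (chow_function L) \bot%O t =
  (t == \bot%O)%:R + \sum_(s | (s < t)%O)
    ia_val (chow_function L) \bot%O s * ('X - 1) ^+ (rho t - rho s).-1.
Proof.
have /(congr1 (fun a => ia_val a \bot%O t)) : chow_function L * eps_bar L = - 1.
  by rewrite /chow_function mulNr mulVr // eps_bar_unit.
rewrite ia_valM ia_valN ia_val1 (bigD1 t) ?le0x ?lexx //= ia_ofE lexx eqxx mulrN1.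
move=> E; rewrite [t == _]eq_sym -[_%:R]opprK -E opprD opprK -addrA.
rewrite [X in _ + X](_ : _ = 0) ?addr0 // addrC; apply/eqP; rewrite subr_eq0.
apply/eqP; apply: eq_big => s; first by rewrite le0x lt_neqAle andbC.
by move=> /[dup] /ltW st /lt_eqF nst; rewrite ia_ofE st nst.
Qed.

(** Since [(x - 1) ^ (rho t - rho s - 1)] completes
    [(1 - x) ^ (rho s + 1)] to [(1 - x) ^ rho t] up to sign, the Chow recursion at
    [t] says that [(1 - x) * F t] is a signed sum of the [F s] with [s < t], which
    is the hypothesis. *)
Lemma chow_bot_coef (F : L -> nat -> int) t :
  (forall s k, (s <= t)%O ->
    \sum_(u | (u <= s)%O) (-1) ^+ (rho s - rho u) * F u k =
    if k is k'.+1 then F s k' else (s == \bot%O)%:R) ->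
  nth 0 (ia_val (chow_function L) \bot%O t) =
  iter (rho t).+1 (@bdiff int) (F t).
Proof.
have [n] := ubnP (rho t); elim: n t => // n IH t tn Ft.
have HE s : (s < t)%O -> nth 0 (ia_val (chow_function L) \bot%O s) =
    iter (rho s).+1 (@bdiff int) (F s).
  move=> st; apply: IH => [|u k us]; first exact: leq_trans (rho_lt st) _.
  by apply: Ft; apply: le_trans (ltW st).
have bF : bdiff (F t) = fun k => (t == \bot%O)%:R *+ (k == 0%N) +
    \sum_(s | (s < t)%O) (-1) ^+ (rho t - rho s).-1 * F s k.
  apply/funext => k; have := Ft t k (lexx t).
  rewrite (bigD1 t) //= subnn expr0 mul1r.
  rewrite (eq_bigl (fun s => (s < t)%O)) => [|s]; last by rewrite lt_neqAle andbC.
  have -> : \sum_(s | (s < t)%O) (-1) ^+ (rho t - rho s) * F s k =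
      - \sum_(s | (s < t)%O) (-1) ^+ (rho t - rho s).-1 * F s k.
    rewrite -sumrN; apply: eq_bigr => s /rho_lt st.
    rewrite -[in LHS](prednK (n := (rho t - rho s)%N)) ?subn_gt0 //.
    by rewrite exprS mulN1r mulNr.
  rewrite /bdiff => /eqP; rewrite subr_eq => /eqP ->.
  by case: k => [|k]; rewrite ?subr0 //= mulr0n add0r addrAC subrr add0r.
rewrite iterSr bF {bF}; have [t0|t0] := eqVneq t \bot%O.
  rewrite t0 rho_bot /= chow_bot_rec eqxx big_pred0 ?addr0 => [|s]; last first.
    by rewrite ltx0.
  by apply/funext => k; rewrite coef1 big_pred0 ?addr0 => [|s]; rewrite ?ltx0.
have -> : (fun k => false%:R *+ (k == 0%N) +
      \sum_(s | (s < t)%O) (-1) ^+ (rho t - rho s).-1 * F s k) =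
    (fun k => \sum_(s | (s < t)%O) (-1) ^+ (rho t - rho s).-1 * F s k).
  by apply/funext => k; rewrite mul0rn add0r.
rewrite (@iter_bdiff_sum int L (index_enum L) (fun s => (s < t)%O)
  (fun s => (-1) ^+ (rho t - rho s).-1) F).
rewrite chow_bot_rec (negbTE t0) add0r; apply/funext => k.
rewrite coef_sum; apply: eq_bigr => s st.
rewrite coef_mul_Xsub1 HE // -iterD; congr (_ * _).
by rewrite addnS -addSn prednK ?subn_gt0 ?rho_lt // subnK // rho_le // ltW.
Qed.

End ChowFromBottom.

Section EulerianZeta.
Context {d : Order.disp_t} {P : finTBPOrderType d} (P_eulerian : eulerian P).
Implicit Types (s t x y : P).

Lemma ia_zeta_unit : (ia_zeta P : incalg int P) \is a GRing.unit.
Proof. by apply: ia_unit_diag1 => s; rewrite ia_ofE lexx. Qed.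

Lemma eulerian_sum_ge s t k : \sum_(u | (s <= u)%O)
    (-1) ^+ (rho u - rho s) * ia_val (ia_zeta P ^+ k.+1 : incalg int P) u t =
  ia_val (ia_zeta P ^+ k : incalg int P) s t.
Proof.
rewrite -[ia_zeta P ^+ k in RHS](mulKr ia_zeta_unit) -exprS ia_valM.
rewrite [LHS](bigID (fun u => (u <= t)%O)) /= addrC big1 ?add0r => [|u].
  by apply: eq_bigr => u /andP[su _]; rewrite (proj2 P_eulerian).
by move=> /andP[_ ut]; rewrite ia_val_out ?mulr0.
Qed.

Lemma eulerian_sum_le s t k : \sum_(u | (u <= t)%O)
    (-1) ^+ (rho t - rho u) * ia_val (ia_zeta P ^+ k.+1 : incalg int P) s u =
  ia_val (ia_zeta P ^+ k : incalg int P) s t.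
Proof.
rewrite -[ia_zeta P ^+ k in RHS](mulrK ia_zeta_unit) -exprSr ia_valM.
rewrite [LHS](bigID (fun u => (s <= u)%O)) /= addrC big1 ?add0r => [|u].
  apply: eq_big => [u|u /andP[ut _]]; first by rewrite andbC.
  by rewrite mulrC (proj2 P_eulerian).
by move=> /andP[_ su]; rewrite ia_val_out ?mulr0.
Qed.

(** [H_P / (1 - x) ^ (r + 1)] is the generating series of [zeta_P(k + 1)]. *)
Lemma eulerian_chow_coef : nth 0 (eulerian_chow P) =
  iter (poset_rank P).+1 (@bdiff int)
    (fun k => ia_val (ia_zeta P ^+ k.+1 : incalg int P) \bot%O \top%O).
Proof.
apply: (chow_bot_coef (F := fun t k => ia_val (ia_zeta P ^+ k.+1) \bot%O t)).
move=> s k _; rewrite eulerian_sum_le; case: k => //.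
by rewrite expr0 ia_val1 eq_sym.
Qed.

End EulerianZeta.

(** * The Chow polynomial of the stellahedral transform *)

Section BooleanSum.
Context (T : finType) (K : comNzRingType).
Implicit Types (E : {set T}).

Lemma sum_subset_sign E (z : K) :
  \sum_(e : {set T} | e \subset E) (-1) ^+ (#|E| - #|e|) * z ^+ #|e| =
  (z - 1) ^+ #|E|.
Proof.
rewrite addrC exprDn.
rewrite (partition_big (fun e : {set T} => inord #|e| : 'I_#|E|.+1) xpredT) //=.
apply: eq_bigr => i _; rewrite -cards_draws.
rewrite -sumr_const; apply: eq_big => e.
  rewrite inE; apply: andb_id2l => /subset_leq_card le.
  by rewrite -val_eqE /= inordK.
by move=> /andP[/subset_leq_card le /eqP <-]; rewrite inordK.
Qed.

(** The chains in a pair of the stellahedral transform are required to contain the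
    minimum of the poset, here [x]; only the other members are free. *)
Lemma sum_pointed_subset_sign x E (z : K) : x \in E ->
  \sum_(e : {set T} | (x \in e) && (e \subset E))
    (-1) ^+ (#|E| - #|e|) * z ^+ #|e|.-1 = (z - 1) ^+ #|E|.-1.
Proof.
move=> xE; rewrite (cardsD1 x E) xE /= -sum_subset_sign.
rewrite (reindex_onto (fun e => x |: e) (fun e => e :\ x)) /=; last first.
  by move=> e /andP[xe _]; rewrite finset.setD1K.
apply: eq_big => e; last first.
  move=> /andP[_ /eqP eE].
  have xe : x \notin e by rewrite -eE !inE eqxx.
  by rewrite cardsU1 xe /= subSS.
rewrite setU11 /= subsetD1; apply/idP/idP => [/andP[sub /eqP eE]|/andP[sub xe]].
  by rewrite -eE !inE eqxx (fintype.subset_trans _ sub) // eE finset.subsetUr.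
by rewrite finset.setU1K // eqxx finset.subUset finset.sub1set xE sub.
Qed.

End BooleanSum.

Section StellChow.
Context {d : Order.disp_t} (P : finTBPOrderType d) (P_eulerian : eulerian P).
Implicit Types (c : {set P}) (x y : P).

Local Notation r := (poset_rank P).

Lemma stell_pair_card c y : stell_pair (c, y) -> (0 < #|c| <= (rho y).+1)%N.
Proof.
move=> /and3P[/= c0 ch /forall_inP cy]; rewrite card_chain_le_rho // andbT.
by rewrite card_gt0; apply/set0Pn; exists \bot%O.
Qed.

Lemma stell_pair_sub c c' y y' : \bot%O \in c' -> c' \subset c -> (y <= y')%O ->
  stell_pair (c, y) -> stell_pair (c', y').
Proof.
move=> c'0 sub yy' /and3P[/= c0 ch /forall_inP cy]; apply/and3P; split=> //=.
  exact: is_chain_sub ch.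
by apply/forall_inP => x /(fintype.subsetP sub) /cy xy; apply: le_trans yy'.
Qed.

Lemma stell_pair_set1 y : stell_pair ([set \bot%O], y).
Proof.
apply/and3P; split; rewrite /= ?inE //; last by apply/forall_inP => x /set1P->.
by apply/is_chainP => x z /set1P-> /set1P->; apply: comparablexx.
Qed.

Definition stell_rank (a : stell P) : nat :=
  if a is Some u then (#|(val u).1|.-1 + (r - rho (val u).2))%N else r.+1.

Lemma rho_stell (a : stell P) : rho a = stell_rank a.
Proof.
move: a; apply: rho_unique => [|a b|].
- by rewrite /= cards1 subnn.
- case: a => [[[c y] u]|]; case: b => [[[c' y'] u']|]; rewrite ?ltxx //=; last first.
    have /= /andP[c0 cy] := stell_pair_card u.
    have := rho_le (lex1 y); rewrite -/r => yr _.
    rewrite ltnS -(leq_add2r (rho y)) -addnA subnK // addnC leq_add2l.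
    by rewrite -ltnS prednK.
  rewrite lt_def => /andP[ne /andP[/= sub yy]].
  have /= /andP[c0 cy] := stell_pair_card u.
  have /= /andP[c0' cy'] := stell_pair_card u'.
  have := rho_le (lex1 y); rewrite -/r => yr.
  move: sub; rewrite finset.subEproper => /predU1P[cE|/proper_card cc].
    have y'y : (rho y' < rho y)%N.
      apply: rho_lt; rewrite lt_neqAle yy andbT; apply: contraNneq ne => yE.
      by apply/eqP; congr Some; apply: val_inj; rewrite /= cE yE.
    by rewrite cE ltn_add2l ltn_sub2l // (leq_trans y'y yr).
  rewrite -addSn leq_add ?prednK //.
    by rewrite -ltnS !prednK.
  by rewrite leq_sub2l // rho_le.
case=> [[[c y] u]|] => [ne|_]; last first.
  exists (Some (exist _ ([set \bot%O], \bot%O) (stell_pair_set1 _))) => //.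
  by rewrite /= cards1 rho_bot subn0.
have /and3P[/= c0 _ _] := u.
have [y1|y1] := eqVneq y \top%O; last first.
  have [y' yy' ry] := graded_cover (proj1 P_eulerian) y1.
  have u' : stell_pair (c, y').
    by apply: (stell_pair_sub _ _ _ u) => //; exact: ltW.
  exists (Some (exist _ (c, y') u')).
    rewrite lt_def; apply/andP; split.
      by apply: contraTneq yy' => -[->]; rewrite ltxx.
    by apply/andP; split=> //=; apply: ltW.
  rewrite /= -addnS ry subnS prednK // subn_gt0; apply: leq_trans (rho_le (lex1 y')).
  by rewrite ry.
(* The pair is not the minimum and [y] is the top, so [c] has another member. *)
have [x xc x0] : exists2 x, x \in c & x != \bot%O.
  apply/exists_inP; apply: contraNT ne; rewrite negb_exists_in => /forall_inP H.
  apply/eqP; congr Some; apply: val_inj; rewrite /= y1; congr pair.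
  apply/setP => x; rewrite inE; apply/idP/idP => [/H|/eqP->]; first by rewrite negbK.
  exact: c0.
have u' : stell_pair (c :\ x, y).
  apply: (stell_pair_sub _ _ _ u) => //; last exact: subD1set.
  by rewrite !inE eq_sym x0.
exists (Some (exist _ (c :\ x, y) u')).
  rewrite lt_def; apply/andP; split.
    apply/negP => /eqP[cE]; move: xc; rewrite cE !inE eqxx //.
  by apply/andP; split=> //=; apply: subD1set.
have /= /andP[c0' _] := stell_pair_card u'.
by rewrite /= (cardsD1 x c) xc /= -addSn prednK.
Qed.

Lemma sum_stell (K : zmodType) (A : pred (stell P)) (F : stell P -> K) :
  ~~ A None ->
  \sum_(a | A a) F a =
  \sum_(cy | stell_pair cy && A (insub cy)) F (insub cy).
Proof.
move=> AN.
(* [insub] sends the pairs that are not in the transform to [None]. *)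
rewrite (reindex_onto (fun cy => insub cy : stell P)
  (fun a => if a is Some u then val u else (finset.set0, \bot%O))) /=; last first.
  by case=> [u _|]; [rewrite valK|move=> AT; rewrite AT in AN].
apply: eq_bigl => cy; rewrite andbC; case: insubP => [u -> ->|/negbTE->].
  by rewrite eqxx.
by rewrite (negbTE AN) andbF.
Qed.

(** For a pair [(c, y)], the number of multichains of [k] elements between the
    minimum [({0}, 1)] and it: each non-minimal member of [c] chooses the step at
    which it enters the chain, or the last one, and the second components form a
    multichain in [[y, 1]].  The value at the adjoined maximum is arbitrary. *)
Definition stell_multichains (a : stell P) (k : nat) : int :=
  if a is Some u then
    k.+1%:R ^+ #|(val u).1|.-1 * ia_val (ia_zeta P ^+ k.+1) (val u).2 \top%O
  else 0.

(** The lower interval of [(c, y)] is a product, and the signed sum factors: its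
    Boolean factor is a binomial expansion of [((k + 1) - 1) ^ (#|c| - 1)], its
    other factor the product of [zeta ^ (k + 1)] by the Moebius function. *)
Lemma stell_multichains_sum (u : {cy | stell_pair cy}) (k : nat) :
  \sum_(b : stell P | (b <= Some u)%O)
    (-1) ^+ (rho (Some u : stell P) - rho b) * stell_multichains b k =
  k%:R ^+ #|(val u).1|.-1 * ia_val (ia_zeta P ^+ k) (val u).2 \top%O.
Proof.
rewrite sum_stell //; case: u => [[c y] u] /=.
have /and3P[/= c0 _ _] := u.
have -> : k%:R = k.+1%:R - 1 :> int by rewrite -natr1 addrK.
rewrite -(eulerian_sum_ge P_eulerian) -(sum_pointed_subset_sign _ c0).
rewrite big_distrlr /= pair_big /=; apply: eq_big => [[c' y']|[c' y']] /=.
  rewrite andbC; case: insubP => [v /= vS vE|vS].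
    rewrite vS andbT /Order.le /= vE /=.
    by have /and3P[/= -> _ _] := vS.
  symmetry; apply/negbTE; apply: contra vS => /andP[/andP[c'0 sub] yy'].
  exact: (stell_pair_sub _ _ _ u).
move=> /andP[vS]; rewrite insubT /= => le.
rewrite !rho_stell /= mulrACA -exprD; congr (_ ^+ _ * _).
move: le => /andP[/= /subset_leq_card cc /rho_le yy].
have /= /andP[c0' _] := stell_pair_card vS.
have := rho_le (lex1 y'); rewrite -/r => yr.
move: cc yy c0' yr; move: #|c| #|c'| (rho y) (rho y') r => *; lia.
Qed.

Lemma stell_chow_coef_pair (u : {cy | stell_pair cy}) :
  nth 0 (ia_val (chow_function (stell P)) \bot%O (Some u : stell P)) =
  iter (rho (Some u : stell P)).+1 (@bdiff int) (stell_multichains (Some u)).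
Proof.
apply: chow_bot_coef => -[v|//] k _; rewrite stell_multichains_sum.
case: k => //; rewrite expr0 ia_val1; case: v => [[c y] v] /=.
have /and3P[/= c0 _ _] := v; have /= /andP[c_gt0 _] := stell_pair_card v.
rewrite expr0n -natrM mulnb; apply: (congr1 (fun b : bool => b%:R)).
apply/andP/eqP => [[cc /eqP y1]|[-> ->]]; last by rewrite cards1 eqxx.
congr Some; apply: val_inj; rewrite /= y1; congr pair; apply/eqP.
rewrite eq_sym eqEcard finset.sub1set c0 cards1.
by rewrite -(prednK c_gt0) (eqP cc).
Qed.

(** One more step of the recursion, at the adjoined maximum, whose rank is
    [r + 1]. *)
Lemma stell_chow_coef : nth 0 (eulerian_chow (stell P)) =
  iter r.+1 (@bdiff int) (fun k => \sum_(cy | stell_pair cy)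
    (-1) ^+ (#|cy.1|.-1 + rho cy.2) * k.+1%:R ^+ #|cy.1|.-1 *
    ia_val (ia_zeta P ^+ k.+1) cy.2 \top%O).
Proof.
have -> : (fun k => \sum_(cy | stell_pair cy)
    (-1) ^+ (#|cy.1|.-1 + rho cy.2) * k.+1%:R ^+ #|cy.1|.-1 *
    ia_val (ia_zeta P ^+ k.+1) cy.2 \top%O) =
  (fun k => \sum_(a : stell P | (a < None :> stell P)%O)
    (-1) ^+ (r.+1 - rho a).-1 * stell_multichains a k).
  apply/funext => k; rewrite sum_stell ?ltxx //; apply: eq_big => -[c y].
    by case: insubP => [v -> _|/negbTE->].
  move=> cy; rewrite insubT /= rho_stell /= -mulrA; congr (_ * _).
  rewrite -signr_odd -[in RHS]signr_odd; congr (_ ^+ nat_of_bool _).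
  have /= := stell_pair_card cy; have := rho_le (lex1 y); rewrite -/r.
  by move: #|c| (rho y) r => *; lia.
rewrite (@iter_bdiff_sum int (stell P) (index_enum _)
  (fun a => (a < None :> stell P)%O)
  (fun a => (-1) ^+ (r.+1 - rho a).-1) stell_multichains).
rewrite /eulerian_chow chow_bot_rec /= add0r; apply/funext => k; rewrite coef_sum.
apply: eq_bigr => -[u|//] _; rewrite coef_mul_Xsub1 stell_chow_coef_pair -iterD.
have -> : rho (None : stell P) = r.+1 by rewrite rho_stell.
congr (_ * _).
have : (rho (Some u : stell P) < r.+1)%N.
  by rewrite -[r.+1]/(stell_rank None) -rho_stell; apply: rho_lt.
move: (rho (Some u : stell P)) => q lt.
have -> : ((r.+1 - q).-1 + q.+1 = r.+1)%N by lia.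
exact: erefl.
Qed.

End StellChow.

(** * Chain sums and the numbers N(k) *)

Section ChainSums.
Context {d : Order.disp_t} {P : finTBPOrderType d}.
Implicit Types (c : {set P}) (v w y : P).

Lemma stell_pair_max c y : stell_pair (c, y) ->
  exists2 w, w \in c & {in c, forall x, (x <= w)%O}.
Proof.
move=> /and3P[/= c0 /is_chainP ch _].
have [w wc wmax] := @arg_maxnP P \bot%O (mem c) rho c0.
exists w => // x xc; case: (comparable_leP (ch x w xc wc)) => // /rho_lt.
by rewrite ltnNge => /negP[]; apply: wmax.
Qed.

Lemma sum_stell_pair_by_max (K : nmodType) (F : {set P} -> K) y :
  \sum_(c | stell_pair (c, y)) F c =
  \sum_(w | (w <= y)%O) \sum_(c | stell_pair (c, w) && (w \in c)) F c.
Proof.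
rewrite (exchange_big_dep (fun c => stell_pair (c, y))) /=; last first.
  move=> w c wy /andP[cw _]; apply: (stell_pair_sub _ _ _ cw) => //.
  by case/and3P: cw.
apply: eq_bigr => c cy; have [w wc wmax] := stell_pair_max cy.
have /and3P[/= c0 ch /forall_inP cley] := cy.
rewrite (big_pred1 w) // => x /=.
apply/andP/eqP => [[_ /andP[/and3P[/= _ _ cx] xc]]|->].
  by apply/le_anti; rewrite (wmax x xc) (forall_inP cx w wc).
by rewrite cley // wc andbT; split=> //; apply/and3P; split=> //; apply/forall_inP.
Qed.

Lemma sum_stell_pair_lt (K : zmodType) (F : {set P} -> K) y :
  \sum_(c | stell_pair (c, y) && (y \notin c)) F c =
  \sum_(w | (w < y)%O) \sum_(c | stell_pair (c, w) && (w \in c)) F c.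
Proof.
have := sum_stell_pair_by_max F y; rewrite (bigID (fun c => y \in c)) /=.
rewrite [in RHS](bigD1 y) //= => /addrI ->.
by apply: eq_bigl => w; rewrite lt_neqAle andbC.
Qed.

(** Removing the maximum [w] of a chain leaves a chain whose maximum is some
    [v < w]. *)
Lemma chain_sum_rec (K : comNzRingType) (z : K) w :
  \sum_(c | stell_pair (c, w) && (w \in c)) z ^+ #|c|.-1 =
  (w == \bot%O)%:R + z * \sum_(v | (v < w)%O)
    \sum_(c | stell_pair (c, v) && (v \in c)) z ^+ #|c|.-1.
Proof.
have [->|w0] := eqVneq w \bot%O.
  rewrite [in RHS]big_pred0 => [|v]; last by rewrite ltx0.
  rewrite mulr0 addr0 (big_pred1 [set \bot%O]) ?cards1 // => c /=.
  apply/andP/eqP => [[/and3P[/= c0 _ /forall_inP cle] _]|->].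
    apply/setP => x; rewrite inE; apply/idP/eqP => [/cle|-> //].
    by rewrite lex0 => /eqP.
  by split; [exact: stell_pair_set1|rewrite inE].
rewrite add0r -sum_stell_pair_lt mulr_sumr.
rewrite (reindex_onto (fun c => w |: c) (fun c => c :\ w)) /=; last first.
  by move=> c /andP[_ wc]; rewrite finset.setD1K.
apply: eq_big => c.
  rewrite setU11 andbT; apply/andP/andP => [[cw /eqP cE]|[cw wc]].
    split; last by rewrite -cE !inE eqxx.
    apply: (stell_pair_sub _ _ _ cw) => //; last exact: finset.subsetUr.
    by case/and3P: cw => /=; rewrite in_setU1 eq_sym (negbTE w0).
  rewrite finset.setU1K // eqxx; split=> //.
  move: cw => /and3P[/= c0 ch /forall_inP cle]; apply/and3P; split=> /=.
  - by rewrite !inE c0 orbT.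
  - exact: is_chain_add.
  - by apply/forall_inP => x /setU1P[->|/cle].
move=> /andP[/andP[cw _] /eqP cE].
have wc : w \notin c by rewrite -cE !inE eqxx.
have c_gt0 : (0 < #|c|)%N.
  rewrite card_gt0; apply/set0Pn; exists \bot%O.
  by case/and3P: cw => /=; rewrite in_setU1 eq_sym (negbTE w0).
by rewrite cardsU1 wc /= -exprS prednK.
Qed.

(** The relation on [B] read in the row of the minimum is the recursion
    [chain_sum_rec] with [z = - (k + 1)]. *)
Lemma chain_sum_inverse (B : incalg int P) (k : nat) w :
  B * (ia_zeta P *+ k.+1 - 1 *+ k) = 1 ->
  ia_val B \bot%O w =
  \sum_(c | stell_pair (c, w) && (w \in c)) (- k.+1%:R) ^+ #|c|.-1.
Proof.
move=> B1; have [n] := ubnP (rho w); elim: n w => // n IH w wn.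
have := congr1 (fun a => ia_val a \bot%O w) B1.
rewrite mulrBr !mulrnAr mulr1 ia_valD ia_valN !ia_valMn.
rewrite ia_val1 chain_sum_rec [_ == w]eq_sym => <-.
rewrite [X in - _ * X](_ : _ = \sum_(v | (v < w)%O) ia_val B \bot%O v); last first.
  by apply: eq_bigr => v vw; rewrite IH // (leq_trans (rho_lt vw)).
rewrite ia_valM [X in X *+ k.+1](_ : _ = ia_val B \bot%O w +
    \sum_(v | (v < w)%O) ia_val B \bot%O v); last first.
  rewrite (bigD1 w) ?le0x ?lexx //= ia_ofE lexx mulr1; congr (_ + _).
  apply: eq_big => v; first by rewrite le0x lt_neqAle andbC.
  by move=> /andP[/andP[_ vw] _]; rewrite ia_ofE vw mulr1.
set b := ia_val _ _ _; set s := (\sum_(v | _) _).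
by rewrite -[(_ + _) *+ _]mulr_natl -[b *+ k]mulr_natl -natr1; ring.
Qed.

End ChainSums.

Section Twist.
Context {d : Order.disp_t} {P : finTBPOrderType d}.
Implicit Types (a b : incalg int P).

(** Conjugation by the diagonal sign matrix [(-1) ^ rho]. *)
Definition ia_twist a : incalg int P :=
  ia_of (fun s t => (-1) ^+ (rho t - rho s) * ia_val a s t).

Lemma ia_twistE a s t : ia_val (ia_twist a) s t =
  (-1) ^+ (rho t - rho s) * ia_val a s t.
Proof. by rewrite ia_ofE; case: ifPn => // st; rewrite ia_val_out ?mulr0. Qed.

Lemma ia_twist1 : ia_twist 1 = 1.
Proof.
apply: ia_ext => s t _; rewrite ia_twistE ia_val1.
by have [->|] := eqVneq s t; rewrite ?mulr0 // subnn mulr1.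
Qed.

Lemma ia_twistM a b : ia_twist (a * b) = ia_twist a * ia_twist b.
Proof.
apply: ia_ext => s t _; rewrite ia_twistE !ia_valM mulr_sumr.
apply: eq_bigr => w /andP[/rho_le sw /rho_le wt].
rewrite !ia_twistE mulrACA -exprD; congr (_ ^+ _ * _); lia.
Qed.

Lemma ia_twistB a b : ia_twist (a - b) = ia_twist a - ia_twist b.
Proof.
by apply: ia_ext => s t _; rewrite ?(ia_valD, ia_valN, ia_twistE) mulrBr.
Qed.

Lemma ia_twistMn a n : ia_twist (a *+ n) = ia_twist a *+ n.
Proof.
by apply: ia_ext => s t _; rewrite ?(ia_valMn, ia_twistE) mulrnAr.
Qed.

Lemma ia_twist_zeta : eulerian P -> ia_twist (ia_zeta P) = (ia_zeta P)^-1.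
Proof.
move=> [_ muP]; apply: ia_ext => s t st.
by rewrite ia_twistE ia_ofE st mulr1 -muP.
Qed.

End Twist.

(** With [U = (k + 1) zeta - k], the sum over the chains below [y] is the entry
    [(0, y)] of [U ^ -1 * zeta].  Since the twist exchanges zeta and the Moebius
    function, it sends [U * zeta ^ -1 = (k + 1) - k * zeta ^ -1] to
    [(k + 1) - k * zeta], so the twist of [U ^ -1 * zeta] is the inverse that
    defines [N(k)]. *)
Lemma sum_stell_pair_N (d : Order.disp_t) (P : finTBPOrderType d) (k : nat) :
  eulerian P ->
  \sum_(cy | stell_pair cy) (-1) ^+ (#|cy.1|.-1 + rho cy.2) *
    k.+1%:R ^+ #|cy.1|.-1 * ia_val (ia_zeta P ^+ k.+1) cy.2 \top%O =
  stell_N P k.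
Proof.
move=> P_eulerian.
pose U : incalg int P := ia_zeta P *+ k.+1 - 1 *+ k.
have U_unit : U \is a GRing.unit.
  apply: ia_unit_diag1 => s; rewrite ia_valD ia_valN !ia_valMn ia_val1 ia_ofE.
  by rewrite lexx eqxx mulrSr addrAC subrr add0r.
have zV : (ia_zeta P)^-1 * ia_zeta P = 1 :> incalg int P.
  by rewrite mulVr ?ia_zeta_unit.
have XE : (ia_delta *+ k.+1 - ia_zeta P *+ k)^-1 = ia_twist (U^-1 * ia_zeta P).
  apply: (mulIr (stell_N_unit P k)); rewrite mulVr ?stell_N_unit //.
  rewrite -ia_twist1 -(mulVr U_unit) !ia_twistM -mulrA; congr (_ * _).
  rewrite /U ia_twistB !ia_twistMn ia_twist1 ia_twist_zeta // mulrBr !mulrnAr.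
  by rewrite zV -[ia_delta]/(1 : incalg int P) mulr1.
have rowE y : ia_val (U^-1 * ia_zeta P) \bot%O y =
    \sum_(c : {set P} | stell_pair (c, y)) (- k.+1%:R) ^+ #|c|.-1.
  rewrite sum_stell_pair_by_max ia_valM; apply: eq_big => w; first by rewrite le0x.
  move=> /andP[_ wy]; rewrite ia_ofE wy mulr1; apply: chain_sum_inverse.
  exact: mulVr.
rewrite /stell_N XE ia_valM.
under [RHS]eq_bigl => y do rewrite le0x lex1.
transitivity (\sum_(c : {set P}) \sum_(y | stell_pair (c, y))
    (-1) ^+ (#|c|.-1 + rho y) * k.+1%:R ^+ #|c|.-1 *
    ia_val (ia_zeta P ^+ k.+1 : incalg int P) y \top%O).
  by rewrite pair_big_dep; apply: eq_big => -[].
rewrite (exchange_big_dep xpredT) //=; apply: eq_bigr => y _.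
rewrite ia_twistE rowE rho_bot subn0 mulr_sumr mulr_suml; apply: eq_bigr => c _.
by rewrite exprD (exprNn k.+1%:R) mulrA [(-1) ^+ rho y * _]mulrC.
Qed.

(** * The expansion of N(m) as a geometric series *)

Section Convergence.
Context {R : realType} {d : Order.disp_t} {P : finTBPOrderType d}.

(** Exponential decay beats the polynomial growth of a binomial coefficient: a
    single term of the binomial expansion of [(1 + e) ^+ n] bounds ['C(n, j)],
    and [e] can be taken so small that [(1 + e) * q] is still less than 1. *)
Lemma cvg_expr_bin (q : R) (j : nat) : 0 <= q < 1 ->
  ((fun n => q ^+ n * 'C(n, j)%:R) @ \oo --> (0 : R))%classic.
Proof.
move=> /andP[q0 q1].
have [e e0 e1] : exists2 e : R, 0 < e & (1 + e) * q < 1.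
  by exists ((1 - q) / 2); nra.
have e_ge0 : 0 <= e := ltW e0.
have q1e : 0 <= (1 + e) * q by rewrite mulr_ge0 // addr_ge0.
have bound n : q ^+ n * 'C(n, j)%:R <= e ^- j * ((1 + e) * q) ^+ n.
  have [nj|jn] := ltnP n j.
    by rewrite bin_small // mulr0 mulr_ge0 ?invr_ge0 ?exprn_ge0.
  rewrite exprMn mulrA [X in _ <= X]mulrC; apply: ler_wpM2l; first exact: exprn_ge0.
  rewrite mulrC ler_pdivlMr ?exprn_gt0 //.
  rewrite exprDn (bigD1 (Ordinal (jn : (j < n.+1)%N))) //= expr1n mul1r.
  rewrite mulr_natl lerDl sumr_ge0 // => i _.
  by rewrite expr1n mul1r mulrn_wge0 // exprn_ge0.
apply: (@squeeze_cvgr _ _ _ _ (fun=> 0) (fun n => e ^- j * ((1 + e) * q) ^+ n)).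
- by apply: nearW => n; rewrite bound andbT mulr_ge0 // exprn_ge0.
- exact: cvg_cst.
rewrite -[X in (_ --> X)%classic](mulr0 (e ^- j)); apply: cvgMl_tmp; apply: cvg_expr.
by rewrite ger0_norm.
Qed.

Lemma ia_val_sum (I : Type) (r : seq I) (F : I -> incalg int P) s t :
  ia_val (\sum_(i <- r) F i) s t = \sum_(i <- r) ia_val (F i) s t.
Proof. by elim/big_rec2: _ => [|i x y _ <-]; rewrite ?ia_val0 ?ia_valD. Qed.

(** The terms with [j >= #|P|] vanish because [zeta - 1] is nilpotent, so the
    number of terms does not depend on [n]; this is what makes the growth of
    [zeta ^ n] polynomial. *)
Lemma ia_zeta_pow_bin (n : nat) (s t : P) :
  ia_val (ia_zeta P ^+ n : incalg int P) s t =
  \sum_(j < #|P|) ia_val ((ia_zeta P - 1) ^+ j : incalg int P) s t *+ 'C(n, j).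
Proof.
set z := ia_zeta P - 1.
have zn : z ^+ #|P| = 0.
  apply: ia_nilpotent => u.
  by rewrite ia_valD ia_valN ia_val1 ia_ofE lexx eqxx subrr.
rewrite -[ia_zeta P](subrK 1) -/z addrC (exprDn_comm _ (commr_sym (commr1 z))).
rewrite ia_val_sum; under eq_bigr do rewrite expr1n mul1r ia_valMn.
pose F i := ia_val (z ^+ i) s t *+ 'C(n, i).
have [le|le] := leqP n.+1 #|P|.
  rewrite (big_ord_widen _ F le) big_mkcond /=; apply: eq_bigr => i _.
  by case: ltnP => // ni; rewrite /F bin_small ?mulr0n.
rewrite [RHS](big_ord_widen _ F (ltnW le)) [RHS]big_mkcond /=; apply: eq_bigr => i _.
case: ltnP => // ni; by rewrite -(subnK ni) exprD zn mulr0 ia_val0 mul0rn.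
Qed.

Lemma cvg_ia_zeta_pow (q : R) (s t : P) : 0 <= q < 1 ->
  ((fun n => q ^+ n * (ia_val (ia_zeta P ^+ n : incalg int P) s t)%:~R)
     @ \oo --> (0 : R))%classic.
Proof.
move=> q01.
have -> : (fun n => q ^+ n * (ia_val (ia_zeta P ^+ n : incalg int P) s t)%:~R) =
   (fun n => \sum_(j < #|P|)
     (ia_val ((ia_zeta P - 1) ^+ j : incalg int P) s t)%:~R *
       (q ^+ n * 'C(n, j)%:R)).
  apply/funext => n; rewrite ia_zeta_pow_bin rmorph_sum /= mulr_sumr.
  by apply: eq_bigr => j _; rewrite rmorphMn /= -mulr_natr mulrCA.
rewrite -[X in (_ --> X)%classic](_ : \sum_(j < #|P|) 0 = 0); last by rewrite big1.
apply: cvg_big => [|j _]; first exact: add_continuous.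
rewrite -[X in (_ --> X)%classic](mulr0
  (ia_val ((ia_zeta P - 1) ^+ j : incalg int P) s t)%:~R).
by apply: cvgMl_tmp; apply: cvg_expr_bin.
Qed.

(** The finite geometric sum of [m * zeta] against [m + 1], cleared of
    denominators, multiplied by [((m + 1) - m * zeta) ^ -1] on the left and
    by [zeta ^ (m + 1)] on the right. *)
Lemma stell_N_geometric_sum (m n : nat) :
  \sum_(j < n) m.+1%:R ^+ (n.-1 - j) * m%:R ^+ j *
    ia_val (ia_zeta P ^+ (m + j).+1 : incalg int P) \bot%O \top%O =
  m.+1%:R ^+ n * stell_N P m - m%:R ^+ n *
    ia_val ((ia_delta *+ m.+1 - ia_zeta P *+ m)^-1 * ia_zeta P ^+ m.+1 *
      ia_zeta P ^+ n : incalg int P) \bot%O \top%O.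
Proof.
set z : incalg int P := ia_zeta P; set V := ia_delta *+ m.+1 - z *+ m.
have V_unit : V \is a GRing.unit := stell_N_unit P m.
have VE : V = 1 *+ m.+1 - z *+ m by [].
have comm1z : GRing.comm (1 *+ m.+1) (z *+ m).
  by apply/commr_sym/commrMn/commr1.
have E : V^-1 * z ^+ m.+1 *+ (m.+1 ^ n) - V^-1 * z ^+ m.+1 * z ^+ n *+ (m ^ n) =
    \sum_(i < n) z ^+ (m + i).+1 *+ (m.+1 ^ (n.-1 - i) * m ^ i).
  have := congr1 (fun a => V^-1 * a * z ^+ m.+1) (subrXX_comm n comm1z).
  rewrite -VE mulKr // => H.
  transitivity (V^-1 * ((1 *+ m.+1) ^+ n - (z *+ m) ^+ n) * z ^+ m.+1).
    rewrite !exprMn_n expr1n mulrBr mulrBl !mulrnAr mulr1 !mulrnAl -!mulrA -!exprD.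
    by rewrite addnC.
  rewrite H mulr_suml; apply: eq_bigr => i _.
  rewrite !exprMn_n expr1n mulrnAr mulrnAl -mulrnA mulrnAl mul1r -exprD mulnC.
  by rewrite -addSn addnC.
have := congr1 (fun a => ia_val a \bot%O \top%O) E.
rewrite ia_val_sum ia_valD ia_valN !ia_valMn => H.
rewrite -!natrX !mulr_natl [RHS]H; apply: eq_bigr => i _.
by rewrite -!natrX -natrM mulr_natl ia_valMn.
Qed.

Lemma cvg_stell_N (m : nat) :
  ((fun n => \sum_(j < n) m%:R ^+ j / m.+1%:R ^+ j.+1 *
     (ia_val (ia_zeta P ^+ (m + j).+1 : incalg int P) \bot%O \top%O)%:~R : R)
   @ \oo --> ((stell_N P m)%:~R : R))%classic.
Proof.
set W : incalg int P := (ia_delta *+ m.+1 - ia_zeta P *+ m)^-1 * ia_zeta P ^+ m.+1.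
pose q : R := m%:R / m.+1%:R.
have m0 : m.+1%:R != 0 :> R by rewrite pnatr_eq0.
have q01 : 0 <= q < 1.
  by rewrite divr_ge0 ?ler0n //= ltr_pdivrMr ?ltr0n // mul1r ltr_nat.
have partialE n : \sum_(j < n) m%:R ^+ j / m.+1%:R ^+ j.+1 *
     (ia_val (ia_zeta P ^+ (m + j).+1 : incalg int P) \bot%O \top%O)%:~R =
   (stell_N P m)%:~R - \sum_w (ia_val W \bot%O w)%:~R *
     (q ^+ n * (ia_val (ia_zeta P ^+ n : incalg int P) w \top%O)%:~R) :> R.
  have mn0 : m.+1%:R ^+ n != 0 :> R by rewrite expf_neq0.
  apply: (mulfI mn0); rewrite mulrBr.
  have := congr1 (fun x : int => x%:~R : R) (stell_N_geometric_sum m n).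
    rewrite -/W rmorphB /= !intrM !rmorphXn /= !rmorph_nat ia_mul_sum => H.
  have -> : m.+1%:R ^+ n * (\sum_w (ia_val W \bot%O w)%:~R *
      (q ^+ n * (ia_val (ia_zeta P ^+ n : incalg int P) w \top%O)%:~R)) =
    m%:R ^+ n * (\sum_w ia_val W \bot%O w *
      ia_val (ia_zeta P ^+ n : incalg int P) w \top%O)%:~R :> R.
    rewrite rmorph_sum !mulr_sumr; apply: eq_bigr => w _ /=.
    rewrite intrM /q exprMn exprVn; field.
    exact: mn0.
  rewrite -H rmorph_sum mulr_sumr; apply: eq_bigr => j _ /=.
  rewrite !intrM !rmorphXn /= !rmorph_nat mulrA; congr (_ * _).
  have -> : m.+1%:R ^+ n = m.+1%:R ^+ (n.-1 - j) * m.+1%:R ^+ j.+1 :> R.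
    by rewrite -exprD; congr (_ ^+ _); move: (ltn_ord j); lia.
  by field; rewrite expf_neq0.
rewrite (funext partialE).
rewrite -[X in (_ --> X)%classic]subr0; apply: cvgB; first exact: cvg_cst.
rewrite -[X in (_ --> X)%classic](_ : \sum_(w : P) 0 = 0); last by rewrite big1.
apply: cvg_big => [|w _]; first exact: add_continuous.
rewrite -[X in (_ --> X)%classic](mulr0 (ia_val W \bot%O w)%:~R).
by apply: cvgMl_tmp; apply: cvg_ia_zeta_pow.
Qed.

Lemma fps_sum_stell_N :
  fps_sum_cvg
    (fun k => fps_of_poly ((zeta_poly P R).[k.+1%:R] *: stell_poly R k))
    (fun k => (stell_N P k)%:~R).
Proof.
move=> m; rewrite -(cvg_shiftn m).
apply: cvg_trans (@cvg_stell_N m); apply: near_eq_cvg; apply: nearW => n /=.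
(* The coefficient of [x ^ m] in the polynomials of index below [m] is zero. *)
rewrite /series /= (@big_cat_nat _ _ _ m) ?leq_addl //=.
rewrite [X in _ = X + _]big_nat [X in _ = X + _]big1 ?add0r => [|k km]; last first.
  rewrite /fps_of_poly coefZ /stell_poly coef_sum big1 ?mulr0 // => i _.
  have im : (m == i) = false by apply/eqP; move: km (ltn_ord i); lia.
  by rewrite coefZ coefXn im mulr0.
rewrite -[X in \sum_(X <= _ < _) _]add0n.
rewrite big_addn addnK big_mkord; apply: eq_bigr => j _.
rewrite zeta_polyP //= /fps_of_poly coefZ /stell_poly coef_sum.
have mj : (m < (j + m).+1)%N by lia.
rewrite (bigD1 (Ordinal mj)) //= big1 ?addr0 => [|i im]; last first.
  rewrite coefZ coefXn; case: eqP => [mi|_]; rewrite ?mulr0 //.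
  by case/eqP: im; apply: val_inj.
rewrite coefZ coefXn eqxx mulr1 addnK mulrC [(j + m)%N]addnC.
by rewrite ia_zeta_multichains rmorph_nat.
Qed.

End Convergence.

(** * The theorem *)

Theorem theorem5p3 (R : realType) (d : Order.disp_t) (P : finTBPOrderType d)
    (r : nat) (P_eulerian : eulerian P) (P_rank : poset_rank P = r) :
  let H_series : fps R :=
    fps_div (fps_of_poly (map_poly intr (eulerian_chow (stell P))))
            (fps_of_poly ((1 - 'X) ^+ r.+1)) in
  [/\ H_series = (fun k => (stell_N P k)%:~R),
      fps_sum_cvg
        (fun k => fps_of_poly ((zeta_poly P R).[k.+1%:R] *: stell_poly R k))
        H_series
    & forall (d' : Order.disp_t) (Q : finTBPOrderType d'),
        eulerian Q -> poset_rank Q = r ->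
        eulerian_chow Q = eulerian_chow P ->
        eulerian_chow (stell Q) = eulerian_chow (stell P)].
Proof.
have stellE (d0 : Order.disp_t) (L : finTBPOrderType d0) : eulerian L ->
    nth 0 (eulerian_chow (stell L)) =
    iter (poset_rank L).+1 (@bdiff int) (stell_N L).
  move=> L_eulerian; rewrite stell_chow_coef //; congr (iter _ _ _).
  by apply/funext => k; apply: sum_stell_pair_N.
move=> H_series; have HE : H_series = (fun k => (stell_N P k)%:~R).
  apply: fps_div_1subX; rewrite iter_bdiff_intr -P_rank -stellE //.
  by apply/funext => k; rewrite coef_map.
split=> //; first by rewrite HE; apply: fps_sum_stell_N.
move=> d' Q Q_eulerian Q_rank QP.
have zetaQP k : num_multichains Q k = num_multichains P k.
  have := congr1 (fun p : {poly int} => nth 0 p) QP.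
  rewrite !eulerian_chow_coef // Q_rank P_rank => /iter_bdiff_inj.
  move=> /(congr1 (fun f => f k)).
  by rewrite !ia_zeta_multichains => /eqP; rewrite eqr_nat => /eqP.
have zpQP : zeta_poly Q R = zeta_poly P R.
  by apply: zeta_poly_unique => n n0; rewrite zeta_polyP // zetaQP.
(* Both are limits of the same series, which depends on the poset only through
   its zeta polynomial. *)
have NQP : stell_N Q = stell_N P.
  apply/funext => k; apply/eqP; rewrite -(eqr_int R); apply/eqP.
  have := @fps_sum_stell_N R _ Q k; rewrite zpQP => cvgQ.
  exact: (cvg_unique _ cvgQ (@fps_sum_stell_N R _ P k)).
by apply/polyP => k; rewrite !stellE // NQP Q_rank P_rank.
Qed.
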